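(* The set of triples $(a,b,c)$ of integers with $1\le a<b<c$ that are pseudoperiods of $\mathbf{vtm}$ is exactly the union of the following three sets: $\{((2^{2i+1}-1)2^{2j+1},\ (2^{2i+2}-1)2^{2j},\ 2^{2i+2j+2}) : i,j\ge0\}$, $\{(3\cdot2^{2j},\ (2^{2i+2}+1)2^{2j+1},\ (2^{2i+1}+1)2^{2j+2}) : i,j\ge0\}$, $\{(2^{2i+2j+3},\ (2^{2i+3}+1)2^{2j},\ (2^{2i+2}+1)2^{2j+1}) : i,j\ge0\}$.
   Context: The ternary (variant) Thue–Morse sequence $\mathbf{vtm}=210201\cdots$ is the infinite fixed point, starting with $2$, of the morphism $2\mapsto210$, $1\mapsto20$, $0\mapsto1$; it is indexed from $0$. A triple $(a,b,c)$ with $1\le a<b<c$ is a pseudoperiod of $\mathbf{vtm}$ if $\mathbf{vtm}[i]\in\{\mathbf{vtm}[i+a],\mathbf{vtm}[i+b],\mathbf{vtm}[i+c]\}$ for all $i\ge0$. *)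

(* Defs.v *)
From mathcomp Require Import all_boot.

Set Implicit Arguments.
Unset Strict Implicit.
Unset Printing Implicit Defensive.

(* Letters are naturals; only 0, 1, 2 are relevant (the last branch is the
   image of 2). *)
Definition vtm_letter (x : nat) : seq nat :=
  match x with
  | 0 => [:: 1]
  | 1 => [:: 2; 0]
  | _ => [:: 2; 1; 0]
  end.

Definition vtm_morph (w : seq nat) : seq nat := flatten (map vtm_letter w).

(* The infinite fixed point starting with 2 is the limit of the words
   [iter n vtm_morph [:: 2]], each a prefix of the next; the word of rank [n]
   has length greater than [n], so the default value is never used.
   See [vtm_fixpoint] and [vtm_unique] below. *)
Definition vtm (n : nat) : nat := nth 0 (iter n vtm_morph [:: 2]) n.

Definition pseudoperiod3 (w : nat -> nat) (a b c : nat) : Prop :=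
  [/\ 1 <= a, a < b, b < c &
      forall i, w i \in [:: w (i + a); w (i + b); w (i + c)]].

Lemma vtm_morph_cat u v : vtm_morph (u ++ v) = vtm_morph u ++ vtm_morph v.
Proof. by rewrite /vtm_morph map_cat flatten_cat. Qed.

Lemma prefix_vtm_morph u v : prefix u v -> prefix (vtm_morph u) (vtm_morph v).
Proof. by move=> /prefixP[t ->]; rewrite vtm_morph_cat prefix_prefix. Qed.

Lemma size_vtm_morph u : size u <= size (vtm_morph u).
Proof.
elim: u => //= x u IHu; rewrite /vtm_morph /= size_cat -add1n leq_add //.
by case: x => [|[|x]].
Qed.

Lemma prefix_vtm_word m n :
  m <= n -> prefix (iter m vtm_morph [:: 2]) (iter n vtm_morph [:: 2]).
Proof.
move=> /subnK <-; elim: (n - m) => [|k IHk]; first exact: prefix_refl.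
apply: prefix_trans IHk _; rewrite addSn.
by elim: (k + m) => // p IHp; rewrite [X in prefix _ X]iterS iterS prefix_vtm_morph.
Qed.

Lemma size_vtm_word n : n < size (iter n vtm_morph [:: 2]).
Proof.
elim: n => // n IHn; have := prefix_vtm_word (leq0n n); move: IHn.
rewrite iterS; set u := iter n _ _ => ltnu /prefixP[t def_u].
rewrite def_u vtm_morph_cat size_cat (leq_ltn_trans ltnu) // def_u size_cat.
by rewrite -addSn leq_add ?size_vtm_morph.
Qed.

Lemma vtm_word n :
  iter n vtm_morph [:: 2] = mkseq vtm (size (iter n vtm_morph [:: 2])).
Proof.
apply: (@eq_from_nth _ 0) => [|i lti]; first by rewrite size_mkseq.
rewrite nth_mkseq // /vtm; have lti' := size_vtm_word i.
have [/prefix_vtm_word|/ltnW/prefix_vtm_word] := leqP i n; move=> /prefixP[t ->];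
  by rewrite nth_cat ?lti' ?lti.
Qed.

Lemma vtm0 : vtm 0 = 2. Proof. by []. Qed.

Lemma vtm_fixpoint n :
  vtm_morph (mkseq vtm n) = mkseq vtm (size (vtm_morph (mkseq vtm n))).
Proof.
have pre k m : k <= m -> prefix (mkseq vtm k) (mkseq vtm m).
  move=> lekm; rewrite prefixE size_mkseq /mkseq -map_take take_iota.
  by rewrite (minn_idPl lekm).
have := pre n _ (ltnW (size_vtm_word n)); rewrite -vtm_word => /prefix_vtm_morph.
rewrite -iterS vtm_word; set u := vtm_morph _ => pre_u.
have le_u := size_prefix pre_u; move: pre_u; rewrite prefixE => /eqP {1}<-.
by rewrite size_mkseq in le_u; rewrite /mkseq -map_take take_iota (minn_idPl le_u).
Qed.

Lemma vtm_unique (w : nat -> nat) :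
    w 0 = 2 ->
    (forall n, vtm_morph (mkseq w n) = mkseq w (size (vtm_morph (mkseq w n)))) ->
  w =1 vtm.
Proof.
move=> w0 fix_w.
have word_w n : iter n vtm_morph [:: 2] = mkseq w (size (iter n vtm_morph [:: 2])).
  elim: n => [|n IHn]; first by rewrite /mkseq /= w0.
  by rewrite iterS IHn; apply: fix_w.
by move=> n; rewrite /vtm word_w nth_mkseq ?size_vtm_word.
Qed.

(* Main.v *)
Require Import Defs.
From mathcomp Require Import all_boot.
From mathcomp Require Import zify.

(** Since [vtm n = 1 + tm (n + 1) - tm n] for the Thue-Morse sequence [tm],
    whether [i] violates the pseudoperiod [(a, b, c)] depends only on the pairs
    [(tm k, tm (k + 1))] for [k = i, i + a, i + b, i + c].  A property
    "[F] holds of these four pairs for all [i]", with [F] a truth table on eight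
    bits, is for [(2a + x, 2b + y, 2c + z)] equivalent to a property of the same
    kind, with another table, for [(a, b, c)].  Hence the ordered pseudoperiods
    are recognised by a finite automaton reading binary digits from the least
    significant one, whose states are tables together with what remains to be
    checked of [0 < a < b < c].  It is compared by computation with a small
    automaton with twelve live states, whose language is the union of the three
    families.  Rejecting states need only be tracked up to enlarging the table,
    which leaves 586 pairs of states to visit. *)

(** * The Thue-Morse sequence and its link with [vtm] *)

Fixpoint tm_rec (k n : nat) : bool :=
  if k is k'.+1 then odd n (+) tm_rec k' n./2 else false.

(** Parity of the binary digit sum. Halving reaches 0 within [n] calls, so [n] itself is enough
    fuel. *)
Definition tm (n : nat) : bool := tm_rec n n.

Lemma tm_rec_stable k m n : n <= k -> n <= m -> tm_rec k n = tm_rec m n.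
Proof.
have tm_rec0 p : tm_rec p 0 = false by elim: p.
elim: k m n => [|k IHk] [|m] n; rewrite ?leqn0 => // le_nk le_nm.
- by rewrite (eqP le_nk) !tm_rec0.
- by rewrite (eqP le_nm) !tm_rec0.
by rewrite /= (IHk m) //; lia.
Qed.

Lemma tm_bit (x : bool) n : tm (x + n.*2) = x (+) tm n.
Proof.
have tm_half m : tm m = odd m (+) tm m./2.
  by case: m => // m; rewrite {1}/tm /= (@tm_rec_stable _ m.+1./2) //; lia.
by rewrite tm_half half_bit_double oddD odd_double oddb addbF.
Qed.

Lemma tm_double n : tm n.*2 = tm n.
Proof. exact: (tm_bit false). Qed.

Lemma tm_doubleS n : tm n.*2.+1 = ~~ tm n.
Proof. exact: (tm_bit true). Qed.

Definition tm_diff (x y : bool) : nat := 1 + y - x.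

(** The image of the letter at [k] has length 2 + tm (k + 1) - tm k, so the lengths telescope to 2n
    + tm n. *)
Lemma vtm_morph_tm_diff n :
  vtm_morph (mkseq (fun k => tm_diff (tm k) (tm k.+1)) n) =
  mkseq (fun k => tm_diff (tm k) (tm k.+1)) (n.*2 + tm n).
Proof.
elim: n => // n IHn; rewrite mkseqS -cats1 vtm_morph_cat IHn.
have tm2 : tm n.*2.+2 = tm n.+1 by rewrite -doubleS tm_double.
have tm3 : tm n.*2.+3 = ~~ tm n.+1 by rewrite -doubleS tm_doubleS.
have [tm0 tm1] := (tm_double n, tm_doubleS n).
case E0: (tm n) => /=; case E1: (tm n.+1); rewrite /vtm_morph /= ?addn1 ?addn0;
  by rewrite doubleS !mkseqS -!cats1 -?catA /= ?tm0 ?tm1 ?tm2 ?tm3 ?E0 ?E1.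
Qed.

Lemma vtm_tm n : vtm n = tm_diff (tm n) (tm n.+1).
Proof.
rewrite -(@vtm_unique (fun k => tm_diff (tm k) (tm k.+1))) // => m.
by rewrite vtm_morph_tm_diff size_mkseq.
Qed.

(** * Truth tables on eight bits *)

Inductive quad (T : Type) : Type := Quad of T & T & T & T.
Arguments Quad {T}.

Definition qget {T} (q : quad T) (u v : bool) : T :=
  let: Quad q00 q01 q10 q11 := q in
  if u then (if v then q11 else q10) else (if v then q01 else q00).

Definition qmake {T} (f : bool -> bool -> T) : quad T :=
  Quad (f false false) (f false true) (f true false) (f true true).

Definition qmap {T U} (f : T -> U) (q : quad T) : quad U :=
  let: Quad q00 q01 q10 q11 := q in Quad (f q00) (f q01) (f q10) (f q11).

Definition qmap2 {T U V} (f : T -> U -> V) (q : quad T) (r : quad U) : quad V :=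
  let: Quad q00 q01 q10 q11 := q in let: Quad r00 r01 r10 r11 := r in
  Quad (f q00 r00) (f q01 r01) (f q10 r10) (f q11 r11).

(* [if] rather than [&&], so that call-by-value evaluation stops early. *)
Definition qall2 {T U} (f : T -> U -> bool) (q : quad T) (r : quad U) : bool :=
  let: Quad q00 q01 q10 q11 := q in let: Quad r00 r01 r10 r11 := r in
  if f q00 r00 then if f q01 r01 then if f q10 r10 then f q11 r11
  else false else false else false.

Lemma qget_make T (f : bool -> bool -> T) u v : qget (qmake f) u v = f u v.
Proof. by case: u; case: v. Qed.

Lemma qget_map T U (f : T -> U) q u v : qget (qmap f q) u v = f (qget q u v).
Proof. by case: q; case: u; case: v. Qed.

Lemma qget_map2 T U V (f : T -> U -> V) q r u v :
  qget (qmap2 f q r) u v = f (qget q u v) (qget r u v).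
Proof. by case: q; case: r; case: u; case: v. Qed.

Lemma qall2_get T U (f : T -> U -> bool) q r u v :
  qall2 f q r -> f (qget q u v) (qget r u v).
Proof. by case: q r u v => ? ? ? ? [? ? ? ?] [] [] /=; do 3 case: ifP => //. Qed.

(* [shift o q] expresses [q (tm (o + 2k)) (tm (o + 2k + 1))] as a table of
   [(tm k, tm (k + 1))], for [o <= 2]. *)
Definition shift {T} (o : nat) (q : quad T) : quad T :=
  let: Quad q00 q01 q10 q11 := q in
  match o with
  | 0 => Quad q01 q01 q10 q10
  | 1 => Quad q10 q11 q00 q01
  | _ => Quad q01 q10 q01 q10
  end.

Lemma qget_shift T (q : quad T) (x y : bool) k :
  qget (shift (x + y) q) (tm k) (tm k.+1) =
  qget q (tm (x + y + k.*2)) (tm (x + y + k.*2).+1).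
Proof.
have [tm0 tm1] := (tm_double k, tm_doubleS k).
have tm2 : tm k.*2.+2 = tm k.+1 by rewrite -doubleS tm_double.
have tm3 : tm k.*2.+3 = ~~ tm k.+1 by rewrite -doubleS tm_doubleS.
case: q x y => ? ? ? ? [] []; rewrite /= ?addn0 ?add1n ?add2n ?tm0 ?tm1 ?tm2 ?tm3;
  by case: (tm k); case: (tm k.+1).
Qed.

(** The nesting levels stand for the positions i, i + a, i + b, i + c in this order. Constructors
    rather than functions make tables comparable by computation. *)
Definition table : Type := quad (quad (quad (quad bool))).

Definition tget (F : table) (p0 p1 a0 a1 b0 b1 c0 c1 : bool) : bool :=
  qget (qget (qget (qget F p0 p1) a0 a1) b0 b1) c0 c1.

Definition tmap2 (op : bool -> bool -> bool) : table -> table -> table :=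
  qmap2 (qmap2 (qmap2 (qmap2 op))).

Definition tle : rel table :=
  qall2 (qall2 (qall2 (qall2 (fun x y => if x then y else true)))).

Definition tshift (o oa ob oc : nat) (F : table) : table :=
  shift o (qmap (fun Fp => shift oa (qmap (fun Fa =>
    shift ob (qmap (shift oc) Fa)) Fp)) F).

(** Conjunction over the parity p of the position p + 2i: adding x + 2a to it gives p + x + 2(i +
    a), whence the offsets. *)
Definition tstep (x y z : bool) (F : table) : table :=
  tmap2 (fun u v => if u then v else false)
    (tshift (false + false) (false + x) (false + y) (false + z) F)
    (tshift (true + false) (true + x) (true + y) (true + z) F).

Definition thold (F : table) (a b c : nat) : Prop :=
  forall i, tget F (tm i) (tm i.+1) (tm (i + a)) (tm (i + a).+1)
    (tm (i + b)) (tm (i + b).+1) (tm (i + c)) (tm (i + c).+1).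

Lemma tget_shift (p x y z : bool) F i a b c :
  tget (tshift (p + false) (p + x) (p + y) (p + z) F)
    (tm i) (tm i.+1) (tm a) (tm a.+1) (tm b) (tm b.+1) (tm c) (tm c.+1) =
  tget F (tm (p + i.*2)) (tm (p + i.*2).+1)
    (tm (p + x + a.*2)) (tm (p + x + a.*2).+1)
    (tm (p + y + b.*2)) (tm (p + y + b.*2).+1)
    (tm (p + z + c.*2)) (tm (p + z + c.*2).+1).
Proof.
by rewrite /tget /tshift !(qget_shift, qget_map) addn0.
Qed.

Lemma thold_step F (x y z : bool) a b c :
  thold F (x + a.*2) (y + b.*2) (z + c.*2) <-> thold (tstep x y z F) a b c.
Proof.
have stepE i : tget (tstep x y z F) (tm i) (tm i.+1) (tm (i + a)) (tm (i + a).+1)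
    (tm (i + b)) (tm (i + b).+1) (tm (i + c)) (tm (i + c).+1) =
  [forall p : bool, tget F (tm (p + i.*2)) (tm (p + i.*2).+1)
    (tm (p + i.*2 + (x + a.*2))) (tm (p + i.*2 + (x + a.*2)).+1)
    (tm (p + i.*2 + (y + b.*2))) (tm (p + i.*2 + (y + b.*2)).+1)
    (tm (p + i.*2 + (z + c.*2))) (tm (p + i.*2 + (z + c.*2)).+1)].
  have swap (p w : bool) k : p + i.*2 + (w + k.*2) = p + w + (i + k).*2 by lia.
  rewrite {1}/tget /tstep /tmap2 !qget_map2 -!/(tget _ _ _ _ _ _ _ _ _).
  rewrite !tget_shift; apply/idP/forallP => [H p|H].
    by move: H; rewrite !swap; case: ifP => // H0 H1; case: p.
  by have := (H true, H false); rewrite !swap => -[-> ->].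
split=> H i; first by rewrite stepE; apply/forallP => p; apply: H.
rewrite -(odd_double_half i).
by have := H i./2; rewrite stepE => /forallP/(_ (odd i)).
Qed.

Lemma thold_le F G a b c : tle F G -> thold F a b c -> thold G a b c.
Proof.
move=> leFG HF i; have := HF i; move: leFG.
move=> /(qall2_get _ _ _ _ _ (tm i) (tm i.+1)).
move=> /(qall2_get _ _ _ _ _ (tm (i + a)) (tm (i + a).+1)).
move=> /(qall2_get _ _ _ _ _ (tm (i + b)) (tm (i + b).+1)).
move=> /(qall2_get _ _ _ _ _ (tm (i + c)) (tm (i + c).+1)).
by rewrite /tget => + HFi; rewrite HFi.
Qed.

(** * States of the automaton reading digits *)

Record state : Type := State
  { st_table : table; st_ab : bool; st_bc : bool; st_a0 : bool }.

(* The flags are carries: the comparison of the digits already read counts in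
   case of equality of what remains. *)
Definition holds (s : state) (a b c : nat) : Prop :=
  [/\ thold (st_table s) a b c, a < b + st_ab s, b < c + st_bc s & 0 < a + st_a0 s].

Definition step (s : state) (x y z : bool) : state :=
  {| st_table := tstep x y z (st_table s);
     st_ab := x < y + st_ab s;
     st_bc := y < z + st_bc s;
     st_a0 := x || st_a0 s |}.

Lemma holds_step s (x y z : bool) a b c :
  holds s (x + a.*2) (y + b.*2) (z + c.*2) <-> holds (step s x y z) a b c.
Proof.
rewrite /holds /=; split=> -[/thold_step HF ab bc a0]; split=> //;
  move: ab bc a0; case: s {HF} => F [] [] [] /=; case: x; case: y; case: z; lia.
Qed.

(** Smaller states are more demanding: flags and table entries enter [holds] monotonically. *)
Definition st_le (s t : state) : bool :=
  if st_ab s ==> st_ab t then if st_bc s ==> st_bc t then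
  if st_a0 s ==> st_a0 t then tle (st_table s) (st_table t)
  else false else false else false.

Lemma holds_le s t a b c : st_le s t -> holds s a b c -> holds t a b c.
Proof.
case: s t => [F u v w] [G u' v' w']; rewrite /st_le /holds /=.
do 3 case: implyP => // ?; move=> /thold_le le_FG [/le_FG HG ? ? ?].
by split=> //; lia.
Qed.

Definition st_final (s : state) : bool :=
  let: State F ab bc a0 := s in
  if [&& ab, bc & a0] then
    all (fun p => tget F p.1 p.2 p.1 p.2 p.1 p.2 p.1 p.2)
      [:: (false, false); (false, true); (true, false); (true, true)]
  else false.

Lemma holds_final s : holds s 0 0 0 <-> st_final s.
Proof.
case: s => F ab bc a0; rewrite /holds /= !add0n !lt0b; split=> [[HF -> -> ->] /=|].
  (* The positions 0, 1, 2, 5 realise all four values of the pair (tm k, tm (k + 1)). *)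
  have := (HF 0, HF 1, HF 2, HF 5); rewrite !addn0.
  by case=> -[[H0 H1] H2 H5]; rewrite H0 H1 H2 H5.
case: ifP => // /and3P[-> -> ->] /and5P[H0 H1 H2 H3 _].
by split=> // i; rewrite !addn0; case: (tm i); case: (tm i.+1).
Qed.

Definition start : state :=
  State (qmake (fun p0 p1 => qmake (fun a0 a1 => qmake (fun b0 b1 => qmake
    (fun c0 c1 => tm_diff p0 p1 \in
      [:: tm_diff a0 a1; tm_diff b0 b1; tm_diff c0 c1])))))
    false false false.

Lemma holds_start a b c : holds start a b c <-> pseudoperiod3 vtm a b c.
Proof.
have startE : thold (st_table start) a b c <->
    forall i, vtm i \in [:: vtm (i + a); vtm (i + b); vtm (i + c)].
  by split=> H i; move: (H i); rewrite !vtm_tm /tget !qget_make.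
by rewrite /holds /pseudoperiod3 /= !addn0; split=> -[? ? ? ?]; split=> //; apply/startE.
Qed.

(* The live states [F1], [F2] and [F3] lead to the first, second and third
   family of the theorem; [F13] is common to two of them.  [Even] and [Odd]
   count the common factors 2 that were divided out. *)
Inductive mstate : Type :=
  Even | Odd | F13 | F1 | F1' | F2 | F2a | F2b | F2b' | F3 | F3' | Done | Sink.

Scheme Boolean Equality for mstate.

Lemma mstate_beqP q r : reflect (q = r) (mstate_beq q r).
Proof. by apply: (iffP idP) => [|->]; [case: q; case: r | case: r]. Qed.

Definition next (q : mstate) (x y z : bool) : mstate :=
  match q, x, y, z with
  | Even, false, false, false => Odd
  | Even, false, true, false => F13
  | Even, true, false, false => F2
  | Odd, false, false, false => Even
  | F13, false, false, true => F3
  | F13, true, true, false => F1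
  | F3, false, false, false => F3'
  | F3', false, false, false => F3
  | F3', true, true, true => Done
  | F1, false, false, true => Done
  | F1, true, true, false => F1'
  | F1', true, true, false => F1
  | F2, true, true, false => F2a
  | F2a, false, false, true => F2b
  | F2b, false, false, false => F2b'
  | F2b, false, true, true => Done
  | F2b', false, false, false => F2b
  | Done, false, false, false => Done
  | _, _, _, _ => Sink
  end.

(** * Exploration of the reachable pairs of states *)

(** A live state must be equivalent to a visited one. Over [Sink] a visited upper bound is enough:
    if it holds of no triple, neither does anything below it. *)
Definition covered (V : seq (state * mstate)) (s : state) (q : mstate) : bool :=
  has (fun t : state * mstate => if mstate_beq q t.2 then
    if st_le s t.1 then if q is Sink then true else st_le t.1 s
    else false else false) V.

Definition bits3 : seq (bool * bool * bool) :=
  [seq (xy, z) | xy <- [seq (x, y) | x <- [:: false; true], y <- [:: false; true]],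
                 z <- [:: false; true]].

Definition successors (s : state) (q : mstate) : seq (state * mstate) :=
  [seq (step s u.1.1 u.1.2 u.2, next q u.1.1 u.1.2 u.2) | u <- bits3].

(** Nothing is proved about this search; only its output is checked, by [closed]. *)
Fixpoint explore (n : nat) (todo V : seq (state * mstate)) :
    seq (state * mstate) :=
  match n, todo with
  | n'.+1, (s, q) :: todo' =>
      if covered V s q then explore n' todo' V
      else explore n' (todo' ++ successors s q) (rcons V (s, q))
  | _, _ => V
  end.

Definition closed (V : seq (state * mstate)) : bool :=
  all (fun t => [&& st_final t.1 == mstate_beq t.2 Done &
                    all (fun u => covered V u.1 u.2) (successors t.1 t.2)]) V.

(** Each of the 586 visited pairs queues eight successors, so 1 + 8 * 586 = 4689 rounds empty the
    queue. *)
Definition reached : seq (state * mstate) :=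
  explore (10 * 500) [:: (start, Even)] [::].

Lemma reached_closed : closed reached.
Proof. by vm_cast_no_check (erefl true). Qed.

Lemma reached_start : covered reached start Even.
Proof. by vm_cast_no_check (erefl true). Qed.

(** * Agreement of the two automata *)

Inductive accepts : mstate -> nat -> nat -> nat -> Prop :=
| accepts_done : accepts Done 0 0 0
| accepts_step q (x y z : bool) a b c :
    accepts (next q x y z) a b c -> accepts q (x + a.*2) (y + b.*2) (z + c.*2).

Lemma accepts_sink a b c : ~ accepts Sink a b c.
Proof.
move Eq: Sink => q acc; elim: acc Eq => // {}q x y z {}a {}b {}c _ IH q_sink.
by apply: IH; rewrite -q_sink.
Qed.

Lemma covered_closed V s q :
  closed V -> covered V s q ->
  exists t, [/\ st_le s t, q = Sink \/ st_le t s,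
    st_final t <-> q = Done &
    forall x y z, covered V (step t x y z) (next q x y z)].
Proof.
rewrite /covered => closedV /(has_nthP (start, Even))[k ltkV].
have := closedV => /(all_nthP (start, Even))/(_ k ltkV).
case: (nth _ V k) => t r /andP[/eqP final_t /and5P[? ? ? ? /and5P[? ? ? ? _]]] /=.
case: mstate_beqP => // ->; case: ifP => // le_st le_ts.
exists t; split=> //; first by case: (r) le_ts; tauto.
  by rewrite final_t; split=> /mstate_beqP.
by case=> [] [] [].
Qed.

(** From left to right, by strong induction on a + b + c: removing the last digits lowers a positive
    sum, and at 0 finality forces [Done]. From right to left, by induction on the accepting run;
    [Sink] accepts nothing. *)
Lemma holds_accepts V s q a b c :
  closed V -> covered V s q -> holds s a b c <-> accepts q a b c.
Proof.
move=> closedV cov; split=> [|acc].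
  have [n] := ubnP (a + b + c); elim: n => // n IHn in s q a b c cov *.
  move=> lt_n Hs.
  have [t [/holds_le/(_ Hs) {}Hs _ final_t cov_t]] := covered_closed _ _ _ closedV cov.
  have [abc0|abc_gt0] := posnP (a + b + c).
    have [a0 b0 c0] : [/\ a = 0, b = 0 & c = 0] by split; lia.
    by subst; move/holds_final/final_t: Hs ->; left.
  move: Hs; rewrite -[a]odd_double_half -[b]odd_double_half -[c]odd_double_half.
  move=> /holds_step Hs; apply: accepts_step; apply: IHn (cov_t _ _ _) _ Hs.
  by lia.
elim: acc s cov => [|{}q x y z {}a {}b {}c acc IH] s cov;
    have [t [_ le_ts final_t cov_t]] := covered_closed _ _ _ closedV cov.
  case: le_ts => // /holds_le; apply; exact/holds_final/final_t.
case: le_ts => [q_sink | /holds_le]; last by apply; apply/holds_step/IH.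
by move: acc; rewrite q_sink => /accepts_sink.
Qed.

(** * The language of the small automaton *)

Definition pow4 (n : nat) : Prop := exists i, n = 4 ^ i.

Lemma pow4_1 : pow4 1. Proof. by exists 0. Qed.

Lemma pow4_mul4 n : pow4 n -> pow4 (4 * n).
Proof. by move=> [i ->]; exists i.+1; rewrite expnS. Qed.

Lemma pow4_gt0 n : pow4 n -> 0 < n.
Proof. by move=> [i ->]; rewrite expn_gt0. Qed.

(** The three families at j = 0, with r = 4^i. *)
Definition family (r a b c : nat) : Prop :=
  [\/ [/\ a = 4 * r - 2, b = 4 * r - 1 & c = 4 * r],
      [/\ a = 3, b = 8 * r + 2 & c = 8 * r + 4]
    | [/\ a = 8 * r, b = 8 * r + 1 & c = 8 * r + 2]].

Definition lang (q : mstate) (a b c : nat) : Prop :=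
  match q with
  | Even => exists r p a' b' c', [/\ pow4 r, pow4 p, family r a' b' c' &
      [/\ a = p * a', b = p * b' & c = p * c']]
  | Odd => exists r p a' b' c', [/\ pow4 r, pow4 p, family r a' b' c' &
      [/\ a = 2 * p * a', b = 2 * p * b' & c = 2 * p * c']]
  | F13 => exists2 r, pow4 r &
      [/\ a = 2 * r - 1, b = 2 * r - 1 & c = 2 * r] \/
      [/\ a = 4 * r, b = 4 * r & c = 4 * r + 1]
  | F1 => exists2 r, pow4 r & [/\ a = r - 1, b = r - 1 & c = r]
  | F1' => exists2 r, pow4 r & [/\ a = 2 * r - 1, b = 2 * r - 1 & c = 2 * r]
  | F2 => exists2 r, pow4 r & [/\ a = 1, b = 4 * r + 1 & c = 4 * r + 2]
  | F2a => exists2 r, pow4 r & [/\ a = 0, b = 2 * r & c = 2 * r + 1]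
  | F2b => exists2 r, pow4 r & [/\ a = 0, b = r & c = r]
  | F2b' => exists2 r, pow4 r & [/\ a = 0, b = 2 * r & c = 2 * r]
  | F3 => exists2 r, pow4 r & [/\ a = 2 * r, b = 2 * r & c = 2 * r]
  | F3' => exists2 r, pow4 r & [/\ a = r, b = r & c = r]
  | Done => [/\ a = 0, b = 0 & c = 0]
  | Sink => False
  end.

Lemma accepts_lang q a b c : accepts q a b c -> lang q a b c.
Proof.
elim=> // {}q x y z {}a {}b {}c _; case: q; case: x; case: y; case: z => //=.
- move=> [r r4 [-> -> ->]]; exists r, 1, 3, (8 * r + 2), (8 * r + 4).
  by split=> //; [exact: pow4_1 | constructor 2 | split; lia].
- move=> [r r4]; have r_gt0 := pow4_gt0 _ r4; case=> -[-> -> ->].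
    exists r, 1, (4 * r - 2), (4 * r - 1), (4 * r).
    by split=> //; [exact: pow4_1 | constructor 1 | split; lia].
  exists r, 1, (8 * r), (8 * r + 1), (8 * r + 2).
  by split=> //; [exact: pow4_1 | constructor 3 | split; lia].
- move=> [r [p [a' [b' [c' [r4 p4 fam [-> -> ->]]]]]]].
  exists r, (4 * p), a', b', c'; split=> //; [exact: pow4_mul4 | split; lia].
- move=> [r [p [a' [b' [c' [r4 p4 fam [-> -> ->]]]]]]].
  by exists r, p, a', b', c'; split=> //; split; lia.
(* In the remaining live cases [r] is kept, except that closing a cycle of length two replaces it by
   4r, and a transition into [Done] from another state starts it at 1. *)
all: try (move=> [r r4 [-> -> ->]]; have r_gt0 := pow4_gt0 _ r4).
all: try by (exists r => //; split; lia).
all: try by (exists (4 * r); [exact: pow4_mul4 | split; lia]).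
all: try by (exists r => //; left; split; lia).
all: try by (exists r => //; right; split; lia).
all: try by (move=> [-> -> ->]; exists 1; [exact: pow4_1 | split; lia]).
by move=> [-> -> ->].
Qed.

(** Leaves the digit decompositions as equations for [lia]. *)
Lemma accepts_step_eq q (x y z : bool) a b c a' b' c' :
  accepts (next q x y z) a b c ->
  a' = x + a.*2 -> b' = y + b.*2 -> c' = z + c.*2 -> accepts q a' b' c'.
Proof. by move=> acc -> -> ->; apply: accepts_step. Qed.

(** One turn of the cycle [F1], [F1'] reads the digits (1, 1, 0) twice, which takes r - 1 to 4r - 1
    and r to 4r. *)
Lemma accepts_F1 i : accepts F1 (4 ^ i - 1) (4 ^ i - 1) (4 ^ i).
Proof.
elim: i => [|i IHi];
  first exact: (accepts_step F1 false false true 0 0 0 accepts_done).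
have: 0 < 4 ^ i by rewrite expn_gt0.
rewrite expnS => r_gt0.
apply: (accepts_step_eq F1 true true false
  (2 * 4 ^ i - 1) (2 * 4 ^ i - 1) (2 * 4 ^ i)); try lia.
by apply: (accepts_step_eq F1' true true false) IHi _ _ _; lia.
Qed.

Lemma accepts_F2b i : accepts F2b 0 (4 ^ i) (4 ^ i).
Proof.
elim: i => [|i IHi];
  first exact: (accepts_step F2b false true true 0 0 0 accepts_done).
rewrite expnS.
apply: (accepts_step_eq F2b false false false
  0 (2 * 4 ^ i) (2 * 4 ^ i)); try lia.
by apply: (accepts_step_eq F2b' false false false) IHi _ _ _; lia.
Qed.

Lemma accepts_F3' i : accepts F3' (4 ^ i) (4 ^ i) (4 ^ i).
Proof.
elim: i => [|i IHi];
  first exact: (accepts_step F3' true true true 0 0 0 accepts_done).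
rewrite expnS.
apply: (accepts_step_eq F3' false false false
  (2 * 4 ^ i) (2 * 4 ^ i) (2 * 4 ^ i)); try lia.
by apply: (accepts_step_eq F3 false false false) IHi _ _ _; lia.
Qed.

Lemma accepts_family i a b c : family (4 ^ i) a b c -> accepts Even a b c.
Proof.
have r_gt0 : 0 < 4 ^ i by rewrite expn_gt0.
case=> -[-> -> ->].
(* Each intermediate triple is the preceding one without its last binary digits. *)
- apply: (accepts_step_eq Even false true false
  (2 * 4 ^ i - 1) (2 * 4 ^ i - 1) (2 * 4 ^ i)); try lia.
  by apply: (accepts_step_eq F13 true true false) (accepts_F1 i) _ _ _; lia.
- apply: (accepts_step_eq Even true false false
  1 (4 * 4 ^ i + 1) (4 * 4 ^ i + 2)); try lia.
  apply: (accepts_step_eq F2 true true false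
    0 (2 * 4 ^ i) (2 * 4 ^ i + 1)); try lia.
  by apply: (accepts_step_eq F2a false false true) (accepts_F2b i) _ _ _; lia.
- apply: (accepts_step_eq Even false true false
  (4 * 4 ^ i) (4 * 4 ^ i) (4 * 4 ^ i + 1)); try lia.
  apply: (accepts_step_eq F13 false false true
    (2 * 4 ^ i) (2 * 4 ^ i) (2 * 4 ^ i)); try lia.
  by apply: (accepts_step_eq F3 false false false) (accepts_F3' i) _ _ _; lia.
Qed.

Lemma accepts_scale j a b c :
  accepts Even a b c -> accepts Even (4 ^ j * a) (4 ^ j * b) (4 ^ j * c).
Proof.
elim: j => [|j IHj] acc; first by rewrite !mul1n.
rewrite !expnS.
apply: (accepts_step_eq Even false false false
  (2 * (4 ^ j * a)) (2 * (4 ^ j * b)) (2 * (4 ^ j * c))); try lia.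
by apply: (accepts_step_eq Odd false false false) (IHj acc) _ _ _; lia.
Qed.

(** * From the automaton to the closed formulas *)

Lemma pseudoperiod3_family a b c :
  pseudoperiod3 vtm a b c <->
  exists i j a' b' c',
    family (4 ^ i) a' b' c' /\ (a, b, c) = (4 ^ j * a', 4 ^ j * b', 4 ^ j * c').
Proof.
have startP := holds_accepts _ _ _ a b c reached_closed reached_start.
split=> [/holds_start/startP/accepts_lang|].
  move=> [_ [_ [a' [b' [c' [[i ->] [j ->] fam [-> -> ->]]]]]]].
  by exists i, j, a', b', c'.
move=> [i [j [a' [b' [c' [/accepts_family fam abcE]]]]]].
by apply/holds_start/startP; case: abcE => -> -> ->; apply: accepts_scale.
Qed.

Theorem theorem24 (a b c : nat) :
  pseudoperiod3 vtm a b c <->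
  [\/ exists i j : nat,
        (a, b, c) = ((2 ^ (2 * i + 1) - 1) * 2 ^ (2 * j + 1),
                     (2 ^ (2 * i + 2) - 1) * 2 ^ (2 * j),
                     2 ^ (2 * i + 2 * j + 2)),
      exists i j : nat,
        (a, b, c) = (3 * 2 ^ (2 * j),
                     (2 ^ (2 * i + 2) + 1) * 2 ^ (2 * j + 1),
                     (2 ^ (2 * i + 1) + 1) * 2 ^ (2 * j + 2))
    | exists i j : nat,
        (a, b, c) = (2 ^ (2 * i + 2 * j + 3),
                     (2 ^ (2 * i + 3) + 1) * 2 ^ (2 * j),
                     (2 ^ (2 * i + 2) + 1) * 2 ^ (2 * j + 1))].
Proof.
have powE i k : 2 ^ (2 * i + k) = 4 ^ i * 2 ^ k by rewrite expnD expnM.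
have pow2E i j k : 2 ^ (2 * i + 2 * j + k) = 4 ^ i * 4 ^ j * 2 ^ k.
  by rewrite 2!expnD 2!expnM.
have pow0E j : 2 ^ (2 * j) = 4 ^ j by rewrite expnM.
have r_gt0 i : 0 < 4 ^ i by rewrite expn_gt0.
split=> [/pseudoperiod3_family[i [j [a' [b' [c' [fam [-> -> ->]]]]]]] | ].
  case: fam => -[-> -> ->]; [constructor 1 | constructor 2 | constructor 3];
  (* Products are distributed over the truncated subtractions, so that only linear identities in
     monomials such as 4^i * 4^j remain. *)
  by exists i, j; rewrite !powE ?pow2E pow0E; congr (_, _, _);
    rewrite ?mulnBl ?mulnBr; lia.
case=> -[i [j [-> -> ->]]]; apply/pseudoperiod3_family; exists i, j.
- exists (4 * 4 ^ i - 2), (4 * 4 ^ i - 1), (4 * 4 ^ i); split; first by constructor 1.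
  by rewrite !powE ?pow2E pow0E; congr (_, _, _); rewrite ?mulnBl ?mulnBr; lia.
- exists 3, (8 * 4 ^ i + 2), (8 * 4 ^ i + 4); split; first by constructor 2.
  by rewrite !powE ?pow2E pow0E; congr (_, _, _); rewrite ?mulnBl ?mulnBr; lia.
- exists (8 * 4 ^ i), (8 * 4 ^ i + 1), (8 * 4 ^ i + 2); split; first by constructor 3.
  by rewrite !powE ?pow2E pow0E; congr (_, _, _); rewrite ?mulnBl ?mulnBr; lia.
Qed.
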